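(* Let $n\ge 2$, $(a,c)\in\mathcal{U}_n$, and $1\le j\le n$. (1) The polynomial $\lambda+a_j$ divides $\chi_n$ if and only if $2\le j\le n-1$ and there exist $\sigma,\tau\in\mathbb{C}^\times$ such that, as identities in $\mathbb{C}[t]$ after setting $\lambda=-a_j$, \[ L_{j-1}=\sigma R_{j+1},\qquad L_{j-2}=\tau R_{j+2},\qquad c_{j-1}\tau+c_j\sigma=0. \] (2) If $\chi_n$ has a factor of $\lambda$-degree one in $\mathbb{C}[\lambda,w]$, given up to a scalar by $\lambda+a_j$, then $j-1=n-j$. In particular $n$ is odd, and the only possible (monic) factor of $\lambda$-degree one of $\chi_n$ for $(a,c)\in\mathcal{U}_n$ is $\lambda+a_{(n+1)/2}$.
   Context: Let $\mathcal{U}_n=\{(a,c)\in\mathbb{C}^{2n-1}: a_i\neq a_j\ (i\neq j),\ c_1\cdots c_{n-1}\neq 0\}$, with $a=(a_1,\ldots,a_n)$ and $c=(c_1,\ldots,c_{n-1})$. For $1\le r\le s\le n$ let $\chi^{(r,\ldots,s)}(\lambda,t)\in\mathbb{C}[\lambda,t]$ be the spectral polynomial of the sub-chain on sites $r,\ldots,s$, i.e. the polynomial $p_s$ obtained from $p_{r-1}=1$, $p_r=\lambda+a_r$, $p_k=(\lambda+a_k)p_{k-1}-t\,c_{k-1}p_{k-2}$ for $r<k\le s$. Put $P_n(\lambda,t)=\chi^{(1,\ldots,n)}(\lambda,t)$ and $\chi_n(\lambda,w)=P_n(\lambda,w^2)$, so that if $c_i=b_i^2$ then $\chi_n(\lambda,w)=\det(\lambda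 I+A+wB)$ with $A=\operatorname{diag}(a_1,\ldots,a_n)$ and $B$ symmetric tridiagonal with zero diagonal and $B_{i,i+1}=B_{i+1,i}=b_i$. For $1\le k\le n$ let $L_k=\chi^{(1,\ldots,k)}$ and $R_k=\chi^{(k,\ldots,n)}$, as polynomials in $(\lambda,t)$, with conventions $L_0=R_{n+1}=1$, $L_{-1}=R_{n+2}=0$, $c_0=c_n=0$. *)

(* Defs.v *)
From mathcomp Require Import all_boot all_order all_algebra.
Set Implicit Arguments.
Unset Strict Implicit.
Unset Printing Implicit Defensive.
Import GRing.Theory.
Local Open Scope ring_scope.

(* F[lambda, t] and F[lambda, w] are both {poly {poly F}}: the outer variable
   is lambda, the inner one is t (resp. w); the lambda-degree of a nonzero f
   is (size f).-1. *)

Section Chain.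
Variables (F : fieldType) (n : nat).
Variables (a : n.-tuple F) (c : n.-1.-tuple F).

(* 1-based access: a_1, ..., a_n are the entries of a.  The leading 0 and the
   default value 0 of nth give c_0 = c_n = 0. *)
Definition a_ (k : nat) : F := nth 0 (0 :: a) k.
Definition c_ (k : nat) : F := nth 0 (0 :: c) k.

Definition inU : Prop :=
  (forall i j : 'I_n, i != j -> tnth a i != tnth a j) /\
  \prod_(i < n.-1) tnth c i != 0.

Definition lin (x : F) : {poly {poly F}} := 'X + (x%:P)%:P.

(* chain r m is the polynomial p_(r + m - 1), for the m sites r, ..., r + m - 1;
   ('X)%:P is the variable t. *)
Fixpoint chain (r m : nat) : {poly {poly F}} :=
  match m with
  | 0 => 1
  | m1.+1 =>
    match m1 with
    | 0 => lin (a_ r)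
    | m2.+1 => lin (a_ (r + m1)) * chain r m1
               - ('X)%:P * ((c_ (r + m1).-1)%:P)%:P * chain r m2
    end
  end.

(* Meaningful for r <= s.+1, with value 1 when r = s.+1. *)
Definition chi (r s : nat) : {poly {poly F}} := chain r (s.+1 - r).

Definition P_n : {poly {poly F}} := chi 1 n.

Definition chi_n : {poly {poly F}} := map_poly (comp_poly 'X^2) P_n.

Definition L_ (k : int) : {poly {poly F}} :=
  match k with Posz m => chi 1 m | Negz _ => 0 end.

Definition R_ (k : nat) : {poly {poly F}} :=
  if (k <= n.+1)%N then chi k n else 0.

(* Setting lambda = x; the result is a polynomial in t. *)
Definition at_lambda (x : F) (p : {poly {poly F}}) : {poly F} := p.[x%:P].

End Chain.

(* Divisibility in F[lambda, w] itself: on {poly {poly F}} the library's %| is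
   pseudo-divisibility, i.e. divisibility in F(w)[lambda]. *)
Definition divides (F : fieldType) (f g : {poly {poly F}}) : Prop :=
  exists q : {poly {poly F}}, g = q * f.

(* Main.v *)
Require Import Defs.
From HB Require Import structures.
From mathcomp Require Import all_boot all_order all_algebra.
From mathcomp Require Import reals.
From mathcomp Require Import complex.
From mathcomp Require Import zify ring.
Set Implicit Arguments.
Unset Strict Implicit.
Unset Printing Implicit Defensive.
Import GRing.Theory.
Local Open Scope ring_scope.

(** Over any field, expanding at site j gives, with L_k, R_k evaluated at
  lambda = - a_j,
    P_n (- a_j) = - t (c_{j-1} L_{j-2} R_{j+1} + c_j L_{j-1} R_{j+2}).
  Every sub-chain avoiding the site j takes at lambda = - a_j, t = 0 a product
  of nonzero differences a_i - a_j ([chain_at0_neq0]).  Hence a single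
  surviving term cannot vanish, which excludes the end sites, and consecutive
  continuants are coprime.  For an interior site, the vanishing of the bracket
  then makes L_{j-1} and R_{j+1} divide each other, which is the
  characterisation of part (1) ([coprime_proportional], [divides_linP]).

  For part (2), the proportionalities L_{j-1} = sigma R_{j+1} and
  L_{j-2} = tau R_{j+2} descend through the three-term recurrences: setting
  t = 0 matches the constant terms, and the remaining ones, divided by t, give a
  proportionality one step further down.  This is the uniqueness of the
  expansion of L_{j-1} / L_{j-2} as a continued fraction in t.  Both descents
  must reach L_{-1} = 0 and R_{n+2} = 0 at the same step, so j - 1 = n - j
  ([continuant_length_eq]).

  Finally, a factor of lambda-degree one of the monic polynomial chi_n is
  k (lambda - x) for a constant k and a polynomial x in w which is a root of
  chi_n.  If the degree of x were at least 2, the term x^n would dominate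
  chi_n (x, w) ([size_chain_w]), so x has degree at most 1.  Modulo w^2,
  chi_n (x, w) is the product of the x + a_i ([chain_w_modX2]); as the a_i are
  distinct, w^2 divides a single factor x + a_j, which forces x = - a_j
  ([chi_n_root]). *)

(** * Polynomials with nonzero constant term *)

Lemma horner0_neq0 (F : fieldType) (p : {poly F}) : p.[0] != 0 -> p != 0.
Proof. by apply: contraNneq => ->; rewrite horner0. Qed.

Lemma XM_eq0 (F : fieldType) (y : F) (p : {poly F}) :
  y%:P * ('X * p) = 0 -> y != 0 -> p = 0.
Proof.
by move/eqP; rewrite !mulf_eq0 polyC_eq0 polyX_eq0 /= => /orP[->|/eqP].
Qed.

Lemma coprimepX_horner0 (F : fieldType) (p : {poly F}) :
  p.[0] != 0 -> coprimep p 'X.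
Proof. by rewrite -['X]subr0 -polyC0 coprimep_XsubC. Qed.

(** The divisibilities L | M and M | L follow from Gauss's lemma. *)
Lemma coprime_proportional (F : fieldType) (y z : F) (L L' M M' : {poly F}) :
  y != 0 -> z != 0 -> M != 0 -> coprimep L L' -> coprimep M M' ->
  y *: (L' * M) + z *: (L * M') = 0 ->
  exists sigma tau : F, [/\ sigma != 0, tau != 0, L = sigma *: M,
                            L' = tau *: M' & y * tau + z * sigma = 0].
Proof.
move=> y0 z0 M0 cL cM E.
have E1 : y *: (L' * M) = - (z *: (L * M')) by apply/eqP; rewrite -addr_eq0 E.
have dLM : L %| M.
  rewrite -(Gauss_dvdpr M cL) -(dvdpZr _ _ y0) E1 dvdpNr dvdpZr //.
  exact: dvdp_mulr.
have dML : M %| L.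
  rewrite -(Gauss_dvdpl L cM) -(dvdpZr _ _ z0) -dvdpNr -E1 dvdpZr //.
  exact: dvdp_mull.
have /eqpP[[s1 s2] /= /andP[s10 s20] Es] : L %= M by rewrite /eqp dLM dML.
have LM : L = (s2 / s1) *: M.
  by rewrite mulrC -scalerA -Es scalerA mulVf // scale1r.
exists (s2 / s1), (- (z * (s2 / s1)) / y).
split=> //.
- by rewrite mulf_neq0 ?invr_neq0.
- by rewrite mulf_neq0 ?invr_neq0 ?oppr_eq0 ?mulf_neq0 ?invr_neq0.
- apply: (mulIf M0); apply: (scalerI y0); rewrite E1 LM.
  rewrite -!scalerAl !scalerA [y * _]mulrC divfK // scaleNr mulrC.
  by rewrite [M * M']mulrC.
by rewrite [y * _]mulrC divfK // addNr.
Qed.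

(** * Three-term recurrences *)

Lemma coprimep_continuant (F : fieldType) (x y : F) (u v w : {poly F}) :
  y != 0 -> w = x%:P * v - y%:P * ('X * u) ->
  v.[0] != 0 -> coprimep v u -> coprimep w v.
Proof.
move=> y0 -> v0 cvu; rewrite coprimep_sym -mulNr -polyCN.
rewrite coprimep_addl_mul mul_polyC coprimepZr ?oppr_eq0 //.
by rewrite coprimepMr cvu coprimepX_horner0.
Qed.

(** Two solutions of three-term recurrences starting from 0 that are
  proportional at two consecutive places have the same length. *)
Lemma continuant_length_eq (F : fieldType) (u v : nat -> {poly F})
    (x y x' y' : nat -> F) (p q : nat) (sigma tau : F) :
  u 0%N = 0 -> v 0%N = 0 ->
  (forall k, (k < p)%N -> (u k.+1).[0] != 0) ->
  (forall k, (k < q)%N -> (v k.+1).[0] != 0) ->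
  (forall k, (k < p)%N ->
     u k.+2 = (x k)%:P * u k.+1 - (y k)%:P * ('X * u k) /\ y k != 0) ->
  (forall k, (k < q)%N ->
     v k.+2 = (x' k)%:P * v k.+1 - (y' k)%:P * ('X * v k) /\ y' k != 0) ->
  sigma != 0 -> tau != 0 ->
  u p.+1 = sigma *: v q.+1 -> u p = tau *: v q -> p = q.
Proof.
move=> u0 v0; elim: p q sigma tau => [|p IHp] [|q] sigma tau u1 v1 hu hv s0 t0.
- by [].
- move=> _; rewrite u0 => /eqP; rewrite eq_sym scaler_eq0 (negPf t0) /=.
  by rewrite (negPf (horner0_neq0 (v1 q (ltnSn q)))).
- move=> _; rewrite v0 scaler0 => /eqP.
  by rewrite (negPf (horner0_neq0 (u1 p (ltnSn p)))).
have [-> yp0] := hu p (ltnSn p); have [-> yq0] := hv q (ltnSn q).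
move=> E1 E2; rewrite E2 in E1.
have vq0 := v1 q (ltnSn q).
(* Comparison of the constant terms of E1. *)
have E0 : x p * tau = sigma * x' q.
  apply: (mulIf vq0); have := congr1 (horner^~ 0) E1.
  by rewrite !hornerE /= !(mulr0, mul0r, subr0) mulrA.
(* What remains of E1 is divisible by 'X, and relates u p and v q. *)
have E3 : u p = (sigma * y' q / y p) *: v q.
  apply: (@mulfI _ 'X); first by rewrite polyX_eq0.
  have yP : (y p)%:P != 0 :> {poly F} by rewrite polyC_eq0.
  apply: (mulfI yP).
  transitivity (sigma%:P * ((y' q)%:P * ('X * v q))).
    have E0' := congr1 polyC E0; rewrite !polyCM in E0'.
    move: E1; rewrite -!mul_polyC mulrBr !mulrA E0' => /addrI/oppr_inj.
    by rewrite -!mulrA.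
  rewrite -mul_polyC !polyCM.
  have : (y p)%:P * (y p)^-1%:P = 1 :> {poly F} by rewrite -polyCM divff.
  move: ((y p)^-1%:P) ((y p)%:P) => i z zi.
  transitivity (z * i * (sigma%:P * ((y' q)%:P * ('X * v q)))).
    by rewrite zi mul1r.
  by ring.
congr _.+1; apply: (IHp q tau (sigma * y' q / y p)) => //.
- by move=> k lk; apply: u1; apply: ltnW.
- by move=> k lk; apply: v1; apply: ltnW.
- by move=> k lk; apply: hu; apply: ltnW.
- by move=> k lk; apply: hv; apply: ltnW.
- by rewrite !mulf_neq0 ?invr_neq0.
Qed.

(** * Divisibility by linear polynomials in lambda *)

Lemma linE (F : fieldType) (x : F) : lin x = 'X - (- x)%:P%:P.
Proof. by rewrite /lin !polyCN opprK. Qed.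

Lemma dividesXsubC (F : fieldType) (x : {poly F}) (p : {poly {poly F}}) :
  divides ('X - x%:P) p <-> p.[x] = 0.
Proof.
split=> [[q ->]|/eqP/factor_theorem[q ->]]; last by exists q.
by rewrite hornerM hornerXsubC subrr mulr0.
Qed.

Lemma divides_scaled (F : fieldType) (k : {poly F}) (f g : {poly {poly F}}) :
  divides (k *: f) g -> divides f g.
Proof. by case=> q ->; exists (k *: q); rewrite -scalerAr scalerAl. Qed.

(** * Sub-chains *)

Section Chains.
Variables (F : fieldType) (n : nat) (a : n.-tuple F) (c : n.-1.-tuple F).
Notation chain := (chain a c).
Notation "'a_" := (a_ a).
Notation "'c_" := (c_ c).

Lemma chainSS r m :
  chain r m.+2 = lin ('a_ (r + m.+1)) * chain r m.+1
                 - ('X)%:P * (('c_ (r + m))%:P)%:P * chain r m.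
Proof. by rewrite /= addnS. Qed.

Lemma chain0 r : chain r 0 = 1. Proof. by []. Qed.

Lemma chain1 r : chain r 1 = lin ('a_ r). Proof. by []. Qed.

(** Cutting a chain between the sites r + m and r + m + 1. *)
Lemma chain_cat r m k :
  chain r (m.+1 + k.+1)
  = chain r m.+1 * chain (r + m.+1) k.+1
    - ('X)%:P * (('c_ (r + m))%:P)%:P * chain r m * chain (r + m.+2) k.
Proof.
elim/ltn_ind: k => -[|[|k]] IH.
- by rewrite addn1 chainSS chain1 chain0 mulr1 [in RHS]mulrC.
- have -> : (m.+1 + 2 = m.+3)%N by lia.
  rewrite !chainSS !chain1 !chain0 !addn0.
  have -> : (r + m.+2 = r + m.+1 + 1)%N by lia.
  by ring.
have -> : (m.+1 + k.+3 = (m.+1 + k.+1).+2)%N by lia.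
rewrite chainSS.
have -> : ((m.+1 + k.+1).+1 = m.+1 + k.+2)%N by lia.
rewrite (IH k.+1) // (IH k) // !(chainSS (r + m.+1)) (chainSS (r + m.+2)).
have -> : (r + (m.+1 + k.+2) = r + m.+1 + k.+2)%N by lia.
have -> : (r + m.+2 + k.+1 = r + m.+1 + k.+2)%N by lia.
have -> : (r + (m.+1 + k.+1) = r + m.+1 + k.+1)%N by lia.
have -> : (r + m.+2 + k = r + m.+1 + k.+1)%N by lia.
by ring.
Qed.

Lemma chainSSl r m :
  chain r m.+2 = lin ('a_ r) * chain r.+1 m.+1
                 - ('X)%:P * (('c_ r)%:P)%:P * chain r.+2 m.
Proof.
by have := chain_cat r 0 m; rewrite add1n addn1 addn0 addn2 => ->;
   rewrite [chain _ 0]/= mulr1.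
Qed.

Lemma chain_monic r m : size (chain r m) = m.+1 /\ chain r m \is monic.
Proof.
elim/ltn_ind: m => -[|[|m]] IH.
- by rewrite /= size_poly1 monic1.
- by rewrite [chain _ 1]/= linE size_XsubC monicXsubC.
rewrite chainSS.
have [s1 m1] := IH m.+1 (ltnSn _); have [s0 m0] := IH m (ltnW (ltnSn _)).
have sl : size (lin ('a_ (r + m.+1)) * chain r m.+1) = m.+3.
  by rewrite linE size_Mmonic ?polyXsubC_eq0 // size_XsubC s1.
have lt : (size (- (('X)%:P * (('c_ (r + m))%:P)%:P * chain r m)%R) < m.+3)%N.
  rewrite size_polyN -polyCM mul_polyC.
  by apply: leq_ltn_trans (size_scale_leq _ _) _; rewrite s0 ltnS leqnSn.
split; first by rewrite size_polyDl sl.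
by rewrite monicE lead_coefDl ?sl // -monicE monicMl // linE monicXsubC.
Qed.

Arguments Defs.chain : simpl never.

(** Expansion of P_n at an interior site. *)
Lemma P_n_split j : (1 < j < n)%N ->
  P_n a c = lin ('a_ j) * (chain 1 j.-1 * chain j.+1 (n - j))
    - ('X)%:P * (('c_ j.-1)%:P)%:P * (chain 1 j.-2 * chain j.+1 (n - j))
    - ('X)%:P * (('c_ j)%:P)%:P * (chain 1 j.-1 * chain j.+2 (n - j).-1).
Proof.
case: j => [|[|j]] // /andP[_ jn]; rewrite /P_n /chi subn1 /=.
have nk : (n = j.+2 + (n - j.+3).+1)%N by lia.
rewrite (congr1 (chain 1) nk) chain_cat chainSS !add1n.
have -> : (n - j.+2 = (n - j.+3).+1)%N by lia.
by rewrite [_.+1.-1]/=; ring.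
Qed.

Lemma P_n_split_first : (2 <= n)%N ->
  P_n a c = lin ('a_ 1) * chain 2 n.-1
    - ('X)%:P * (('c_ 1)%:P)%:P * chain 3 n.-2.
Proof.
move=> n2; have nk : n = n.-2.+2 by lia.
rewrite /P_n /chi subn1 /= (congr1 (chain 1) nk) chainSSl.
by have -> : n.-2.+1 = n.-1 by lia.
Qed.

Lemma P_n_split_last : (2 <= n)%N ->
  P_n a c = lin ('a_ n) * chain 1 n.-1
    - ('X)%:P * (('c_ n.-1)%:P)%:P * chain 1 n.-2.
Proof.
move=> n2; have nk : n = n.-2.+2 by lia.
rewrite /P_n /chi subn1 /= (congr1 (chain 1) nk) chainSS !add1n.
have -> : n.-2.+2 = n by lia.
by have -> : n.-2.+1 = n.-1 by lia.
Qed.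

(** * Evaluation at a constant *)

Lemma divides_lin (x : F) : divides (lin x) (chi_n a c) <->
  at_lambda (- x) (P_n a c) = 0.
Proof.
rewrite linE dividesXsubC /chi_n /at_lambda.
rewrite -[in X in X <-> _](comp_polyC (- x) 'X^2) horner_map /=.
split=> [/eqP|->]; last by rewrite comp_poly0.
by rewrite comp_poly_eq0 ?size_polyXn // => /eqP.
Qed.

Lemma at_linM (x y : F) p : at_lambda x (lin y * p) = (x + y)%:P * at_lambda x p.
Proof. by rewrite /at_lambda hornerM /lin hornerD hornerX hornerC polyCD. Qed.

Lemma at_tM (x y : F) p :
  at_lambda x ('X%:P * y%:P%:P * p) = y%:P * ('X * at_lambda x p).
Proof. by rewrite /at_lambda !hornerM !hornerC -mulrA mulrCA. Qed.

Lemma at_B x (p q : {poly {poly F}}) :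
  at_lambda x (p - q) = at_lambda x p - at_lambda x q.
Proof. by rewrite /at_lambda hornerD hornerN. Qed.

Lemma at_M x (p q : {poly {poly F}}) :
  at_lambda x (p * q) = at_lambda x p * at_lambda x q.
Proof. by rewrite /at_lambda hornerM. Qed.

Lemma chain_at0 (x : F) r m :
  (at_lambda x (chain r m)).[0] = \prod_(i < m) (x + 'a_ (r + i)).
Proof.
elim/ltn_ind: m => -[|[|m]] IH.
- by rewrite big_ord0 /at_lambda !hornerC.
- rewrite big_ord1 -[chain r 1]mulr1 at_linM /at_lambda hornerC mulr1 addn0.
  by rewrite hornerC.
rewrite chainSS at_B at_linM at_tM big_ord_recr /=.
by rewrite !hornerE /= IH // !(mulr0, mul0r, subr0) mulrC.
Qed.

(** * Sites of a chain with distinct a_i and nonzero c_i *)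

Hypothesis U : inU a c.

Lemma a_inj i j : (0 < i <= n)%N -> (0 < j <= n)%N -> 'a_ i = 'a_ j -> i = j.
Proof.
case: i j => [|i] [|j] //= hi hj; rewrite /a_ /= => E.
case: U => /(_ (Ordinal hi) (Ordinal hj)) + _.
rewrite !(tnth_nth 0) /= E eqxx.
by case: (eqVneq (Ordinal hi) (Ordinal hj)) => [[->]|_ /(_ isT)].
Qed.

Lemma c_neq0 i : (0 < i < n)%N -> 'c_ i != 0.
Proof.
case: i => [|i] //= hi; have hi' : (i < n.-1)%N by lia.
case: U => _ /prodf_neq0/(_ (Ordinal hi') isT).
by rewrite (tnth_nth 0).
Qed.

Lemma chain_at0_neq0 j r m : (0 < j <= n)%N -> (0 < r)%N -> (r + m <= n.+1)%N ->
  (j < r)%N || (r + m <= j)%N -> (at_lambda (- 'a_ j) (chain r m)).[0] != 0.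
Proof.
move=> hj r0 rm jrm; rewrite chain_at0; apply/prodf_neq0 => i _.
have im := ltn_ord i; rewrite addrC subr_eq0; apply/eqP => /a_inj.
by move=> /(_ _ hj); lia.
Qed.

Lemma coprimep_chainr j m : (0 < j <= n)%N -> (m < j)%N -> (m.+1 < n)%N ->
  coprimep (at_lambda (- 'a_ j) (chain 1 m.+1)) (at_lambda (- 'a_ j) (chain 1 m)).
Proof.
move=> hj; elim: m => [_ _|m IH mj mn].
  by rewrite [at_lambda _ (chain 1 0)]/at_lambda hornerC coprimep1.
apply: (@coprimep_continuant F (- 'a_ j + 'a_ (1 + m.+1)) ('c_ (1 + m))
  (at_lambda (- 'a_ j) (chain 1 m))).
- by apply: c_neq0; lia.
- by rewrite chainSS at_B at_linM at_tM.
- by apply: chain_at0_neq0; lia.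
by apply: IH; lia.
Qed.

Lemma coprimep_chainl j m : (0 < j <= n)%N -> (j + m < n)%N ->
  coprimep (at_lambda (- 'a_ j) (chain (n - m) m.+1))
           (at_lambda (- 'a_ j) (chain (n - m).+1 m)).
Proof.
move=> hj; elim: m => [_|m IH jm].
  by rewrite [at_lambda _ (chain _ 0)]/at_lambda hornerC coprimep1.
have nm : (n - m = (n - m.+1).+1)%N by lia.
rewrite nm in IH.
apply: (@coprimep_continuant F (- 'a_ j + 'a_ (n - m.+1)) ('c_ (n - m.+1))
  (at_lambda (- 'a_ j) (chain (n - m.+1).+2 m))).
- by apply: c_neq0; lia.
- by rewrite chainSSl at_B at_linM at_tM.
- by apply: chain_at0_neq0; lia.
by apply: IH; lia.
Qed.

Lemma L_pred j : (0 < j)%N -> L_ a c (j%:Z - 1) = chain 1 j.-1.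
Proof. by case: j => [|j] // _; rewrite -addn1 PoszD addrK /L_ /chi subn1 addn1. Qed.

Lemma L_pred2 j : (1 < j)%N -> L_ a c (j%:Z - 2) = chain 1 j.-2.
Proof.
by case: j => [|[|j]] // _; rewrite -addn2 PoszD addrK /L_ /chi subn1 addn2.
Qed.

Lemma R_succ j : (j <= n)%N -> R_ a c (j + 1) = chain j.+1 (n - j).
Proof. by move=> jn; rewrite /R_ /chi addn1 ltnS jn subSS. Qed.

Lemma R_succ2 j : (j < n)%N -> R_ a c (j + 2) = chain j.+2 (n - j).-1.
Proof. by move=> jn; rewrite /R_ /chi addn2 ltnS jn subSS; congr chain; lia. Qed.

Lemma P_n_at_interior j : (1 < j < n)%N ->
  let e := at_lambda (- 'a_ j) in
  e (P_n a c) = - 'X *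
    ('c_ j.-1 *: (e (chain 1 j.-2) * e (chain j.+1 (n - j)))
     + 'c_ j *: (e (chain 1 j.-1) * e (chain j.+2 (n - j).-1))).
Proof.
move=> hj e; rewrite (P_n_split hj) /e !at_B at_linM !at_tM !at_M addNr.
by rewrite -!mul_polyC; ring.
Qed.

Lemma divides_lin_interior j : (1 < j < n)%N ->
  let e := at_lambda (- 'a_ j) in
  divides (lin ('a_ j)) (chi_n a c) <->
  'c_ j.-1 *: (e (chain 1 j.-2) * e (chain j.+1 (n - j)))
  + 'c_ j *: (e (chain 1 j.-1) * e (chain j.+2 (n - j).-1)) = 0.
Proof.
move=> hj e; rewrite divides_lin (P_n_at_interior hj) -/e.
split=> [/eqP|->]; last by rewrite mulr0.
by rewrite mulf_eq0 oppr_eq0 polyX_eq0 => /eqP.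
Qed.

(** At an end site a single term of the expansion survives, and it is not 0. *)
Lemma divides_lin_bounds j : (2 <= n)%N -> (1 <= j <= n)%N ->
  divides (lin ('a_ j)) (chi_n a c) -> (1 < j < n)%N.
Proof.
move=> n2 hj; rewrite divides_lin => P0.
have [j1|j1] := eqVneq j 1%N.
  rewrite j1 in hj P0; have cp : (at_lambda (- 'a_ 1) (chain 3 n.-2)).[0] != 0.
    by apply: chain_at0_neq0; lia.
  move: P0; rewrite (P_n_split_first n2) at_B at_linM at_tM addNr mul0r sub0r.
  move/eqP; rewrite oppr_eq0 => /eqP/XM_eq0 E.
  by rewrite E ?horner0 ?eqxx // in cp; apply: c_neq0; lia.
have [jn|jn] := eqVneq j n; last by lia.
rewrite jn in hj P0; have cp : (at_lambda (- 'a_ n) (chain 1 n.-2)).[0] != 0.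
  by apply: chain_at0_neq0; lia.
move: P0; rewrite (P_n_split_last n2) at_B at_linM at_tM addNr mul0r sub0r.
move/eqP; rewrite oppr_eq0 => /eqP/XM_eq0 E.
by rewrite E ?horner0 ?eqxx // in cp; apply: c_neq0; lia.
Qed.

Lemma divides_linP j : (2 <= n)%N -> (1 <= j <= n)%N ->
  let e := at_lambda (- 'a_ j) in
  divides (lin ('a_ j)) (chi_n a c) <->
  (2 <= j <= n.-1)%N /\
  exists sigma tau : F,
    [/\ sigma != 0, tau != 0,
        e (L_ a c (j%:Z - 1)) = sigma *: e (R_ a c (j + 1)),
        e (L_ a c (j%:Z - 2)) = tau *: e (R_ a c (j + 2)) &
        'c_ (j - 1) * tau + 'c_ j * sigma = 0].
Proof.
move=> n2 hj e; split=> [D|[hj2 [sigma [tau [s0 t0]]]]].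
  have jn := divides_lin_bounds n2 hj D.
  split; first by lia.
  rewrite L_pred ?L_pred2 ?R_succ ?R_succ2 ?subn1; try by lia.
  move: D; rewrite (divides_lin_interior jn) -/e; apply: coprime_proportional.
  - by apply: c_neq0; lia.
  - by apply: c_neq0; lia.
  - by apply: horner0_neq0; apply: chain_at0_neq0; lia.
  - have -> : j.-1 = j.-2.+1 by lia.
    by apply: coprimep_chainr; lia.
  have := @coprimep_chainl j (n - j).-1 hj.
  have -> : (n - (n - j).-1 = j.+1)%N by lia.
  have -> : ((n - j).-1.+1 = n - j)%N by lia.
  by apply; lia.
have jn : (1 < j < n)%N by lia.
rewrite L_pred ?L_pred2 ?R_succ ?R_succ2 ?subn1; try by lia.
move=> E1 E2 E3; rewrite (divides_lin_interior jn) -/e E1 E2.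
by rewrite -!scalerAl !scalerA [X in _ *: X + _]mulrC -scalerDl E3 scale0r.
Qed.

(** At lambda = - a_j, both chains are read towards the site j: u k is L_{k-1} and
  v k is R_{n+2-k}, with u 0 = L_{-1} = 0 and v 0 = R_{n+2} = 0. *)
Lemma divides_lin_middle j : (2 <= n)%N -> (1 <= j <= n)%N ->
  divides (lin ('a_ j)) (chi_n a c) -> (j - 1 = n - j)%N.
Proof.
move=> n2 hj D; have jn := divides_lin_bounds n2 hj D.
have /(divides_linP n2 hj)[_ [sigma [tau [s0 t0]]]] := D.
rewrite L_pred ?L_pred2 ?R_succ ?R_succ2; try by lia.
move=> E1 E2 _.
pose e := at_lambda (- 'a_ j).
pose u k := if k is m.+1 then e (chain 1 m) else 0.
pose v k := if k is m.+1 then e (chain (n.+1 - m) m) else 0.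
(* The coefficients of u 0 and v 0 are irrelevant; 1 keeps them nonzero. *)
pose y k := if k is 0 then 1 else 'c_ k.
pose y' k := if k is 0 then 1 else 'c_ (n - k).
apply: (@continuant_length_eq F u v (fun k => - 'a_ j + 'a_ k.+1) y
  (fun k => - 'a_ j + 'a_ (n - k)) y' _ _ sigma tau) => //.
- by move=> k kj; apply: chain_at0_neq0; lia.
- by move=> k kj; apply: chain_at0_neq0; lia.
- move=> [|k] kj.
    split; last by rewrite oner_neq0.
    by rewrite /u /e -[chain 1 1]mulr1 at_linM mulr0 mulr0 subr0.
  split; last by apply: c_neq0; lia.
  by rewrite /u /e chainSS at_B at_linM at_tM.
- move=> [|k] kj.
    split; last by rewrite oner_neq0.
    rewrite /v /e !mulr0 subr0 subn0 subn1 -[chain _ 1]mulr1 at_linM.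
    by rewrite /= chain0.
  split; last by apply: c_neq0; lia.
  rewrite /v /e.
  have -> : (n.+1 - k.+2 = n - k.+1)%N by lia.
  have -> : (n.+1 - k.+1 = (n - k.+1).+1)%N by lia.
  have -> : (n.+1 - k = (n - k.+1).+2)%N by lia.
  by rewrite chainSSl at_B at_linM at_tM.
- rewrite /u /v subn1.
  by have -> : (n.+1 - (n - j) = j.+1)%N by lia.
have -> : (j - 1 = j.-2.+1)%N by lia.
have -> : (n - j = (n - j).-1.+1)%N by lia.
rewrite /u /v.
by have -> : (n.+1 - (n - j).-1 = j.+2)%N by lia.
Qed.

(** * Factors of lambda-degree one *)

(** The polynomial [chain r m] at lambda = x(w), t = w^2, where w is the
  variable of x. *)
Definition chain_w (x : {poly F}) r m : {poly F} :=
  (map_poly (comp_poly 'X^2) (chain r m)).[x].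

Lemma chain_w0 x r : chain_w x r 0 = 1.
Proof. by rewrite /chain_w chain0 rmorph1 hornerC. Qed.

Lemma chain_wSS x r m : chain_w x r m.+2 =
  (x + ('a_ (r + m.+1))%:P) * chain_w x r m.+1
  - ('c_ (r + m))%:P * ('X^2 * chain_w x r m).
Proof.
rewrite /chain_w chainSS rmorphB !rmorphM /= !map_polyC /= /lin rmorphD /=.
rewrite map_polyX map_polyC /= comp_polyX !comp_polyC.
by rewrite hornerD hornerN !hornerM hornerD hornerX !hornerC; ring.
Qed.

Lemma chain_w1 x r : chain_w x r 1 = x + ('a_ r)%:P.
Proof.
rewrite /chain_w chain1 /lin rmorphD /= map_polyX map_polyC /= comp_polyC.
by rewrite hornerD hornerX hornerC.
Qed.

(** When deg x >= 2, the term x^m dominates. *)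
Lemma size_chain_w (x : {poly F}) r m :
  (2 < size x)%N -> size (chain_w x r m) = (m * (size x).-1).+1.
Proof.
move=> sx; have sxa b : size (x + b%:P) = size x.
  by rewrite size_polyDl // (leq_ltn_trans (size_polyC_leq1 _)) // ltnW.
elim/ltn_ind: m => -[|[|m]] IH.
- by rewrite chain_w0 size_poly1.
- by rewrite chain_w1 sxa; lia.
have s1 := IH m.+1 (ltnSn _); have s0 := IH m (ltnW (ltnSn _)).
have xa0 : x + ('a_ (r + m.+1))%:P != 0 by rewrite -size_poly_gt0 sxa; lia.
have e0 : chain_w x r m.+1 != 0 by rewrite -size_poly_gt0 s1.
rewrite chain_wSS size_polyDl size_mul // sxa s1; first by lia.
rewrite size_polyN mul_polyC; apply: leq_ltn_trans (size_scale_leq _ _) _.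
rewrite mulrC size_mulXn -?size_poly_gt0 s0 //; nia.
Qed.

Lemma chain_w_modX2 (x : {poly F}) r m :
  'X^2 %| chain_w x r m - \prod_(i < m) (x + ('a_ (r + i))%:P).
Proof.
elim/ltn_ind: m => -[|[|m]] IH.
- by rewrite chain_w0 big_ord0 subrr dvdp0.
- by rewrite chain_w1 big_ord1 addn0 subrr dvdp0.
rewrite chain_wSS big_ord_recr /= mulrC addrAC -mulrBl.
apply: dvdp_sub; first by apply: dvdp_mulr; apply: IH.
by apply: dvdp_mull; apply: dvdp_mulr.
Qed.

Lemma chi_n_root x : (2 <= n)%N -> (chi_n a c).[x] = 0 ->
  exists2 j, (1 <= j <= n)%N & x = - ('a_ j)%:P.
Proof.
move=> n2; have -> : chi_n a c = map_poly (comp_poly 'X^2) (chain 1 n).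
  by rewrite /chi_n /P_n /chi subn1.
rewrite -/(chain_w x 1 n) => E.
have sx : (size x <= 2)%N.
  rewrite leqNgt; apply/negP => sx; have := size_chain_w 1 n sx.
  by rewrite E size_poly0.
have := chain_w_modX2 x 1 n; rewrite E sub0r dvdpNr => D.
have /prodf_eq0/= P0 : \prod_(i < n) (x.[0] + 'a_ (1 + i)) == 0.
  have : 'X %| \prod_(i < n) (x + ('a_ (1 + i))%:P).
    by apply: dvdp_trans D; rewrite expr2 dvdp_mulIl.
  rewrite -['X]subr0 -polyC0 dvdp_XsubCl /root horner_prod.
  by under eq_bigr do rewrite hornerD hornerC.
(* x + a_i vanishes at w = 0 for this i only, so it carries all of w^2. *)
have [i _ /eqP xi] := P0; exists (1 + i)%N; first by have := ltn_ord i; lia.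
apply/eqP; rewrite -addr_eq0; apply/eqP.
have : 'X^2 %| x + ('a_ (1 + i))%:P.
  move: D; rewrite (bigD1 i) //= Gauss_dvdpl //.
  rewrite coprimep_expl // coprimep_sym coprimepX_horner0 // horner_prod.
  apply/prodf_neq0 => k ki; rewrite hornerD hornerC.
  apply: contraNneq ki => xk; apply/eqP/ord_inj.
  suff: (1 + k = 1 + i)%N by lia.
  apply: a_inj; try by have := ltn_ord i; have := ltn_ord k; lia.
  by apply: (addrI x.[0]); rewrite xi xk.
apply: contraTeq => xa0; apply/negP => /(dvdp_leq xa0).
rewrite size_polyXn leqNgt ltnS; apply/negP; rewrite negbK.
apply: leq_trans (size_polyD _ _) _.
by rewrite geq_max sx; apply: leq_trans (size_polyC_leq1 _) _.
Qed.

Lemma chi_n_monic : chi_n a c \is monic.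
Proof. by rewrite /chi_n monic_map //; have [_ ] := chain_monic 1 (n.+1 - 1). Qed.

Lemma linear_factor (f : {poly {poly F}}) : (2 <= n)%N ->
  size f = 2%N -> divides f (chi_n a c) ->
  exists j k, [/\ (1 <= j <= n)%N, k != 0, f = k%:P *: lin ('a_ j) &
                  divides (lin ('a_ j)) (chi_n a c)].
Proof.
move=> n2 sf [q Eq].
have D : divides f (chi_n a c) by exists q.
have ql : lead_coef q * lead_coef f = 1.
  by rewrite -lead_coefM -Eq; apply/eqP; rewrite -monicE chi_n_monic.
have : lead_coef f %| 1 by rewrite -ql dvdp_mulIr.
rewrite dvdp1 => /eqP/eqP/size_poly1P[k k0 fk].
have Ef : f = k%:P *: ('X - (- k^-1%:P * f`_0)%:P).
  have kk : k%:P * k^-1%:P = 1 :> {poly F} by rewrite -polyCM divff.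
  rewrite mulNr polyCN opprK scalerDr -!mul_polyC -polyCM mulrA kk mul1r.
  rewrite -fk lead_coefE sf; apply/polyP => i.
  rewrite coefD coefCM coefX coefC.
  case: i => [|[|i]] /=; rewrite ?mulr0 ?mulr1 ?add0r ?addr0 //.
  by rewrite nth_default // sf.
have : divides ('X - (- k^-1%:P * f`_0)%:P) (chi_n a c).
  by apply: (@divides_scaled _ k%:P); rewrite -Ef.
rewrite dividesXsubC => /(chi_n_root n2)[j hj xj].
have fj : f = k%:P *: lin ('a_ j) by rewrite Ef xj linE (polyCN ('a_ j)).
by exists j, k; split=> //; apply: (@divides_scaled _ k%:P); rewrite -?fj.
Qed.

End Chains.

Theorem theorem5p3 (R : realType) (n : nat)
    (a : n.-tuple (complex R)) (c : n.-1.-tuple (complex R)) :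
  (2 <= n)%N -> inU a c ->
  (forall j : nat, (1 <= j <= n)%N ->
     (divides (lin (a_ a j)) (chi_n a c) <->
      (2 <= j <= n.-1)%N /\
      exists sigma tau : complex R,
        [/\ sigma != 0, tau != 0,
            at_lambda (- a_ a j) (L_ a c (j%:Z - 1))
              = sigma *: at_lambda (- a_ a j) (R_ a c (j + 1)),
            at_lambda (- a_ a j) (L_ a c (j%:Z - 2))
              = tau *: at_lambda (- a_ a j) (R_ a c (j + 2)) &
            c_ c (j - 1) * tau + c_ c j * sigma = 0]) /\
     (forall (f : {poly {poly (complex R)}}) (k : complex R),
        size f = 2%N -> divides f (chi_n a c) ->
        k != 0 -> f = k%:P *: lin (a_ a j) ->
        (j - 1 = n - j)%N)) /\
  (forall f : {poly {poly (complex R)}},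
     size f = 2%N -> divides f (chi_n a c) ->
     odd n /\
     exists k : complex R, k != 0 /\ f = k%:P *: lin (a_ a ((n + 1) %/ 2))).
Proof.
move=> n2 U; split=> [j hj|f sf D].
  split; first exact: divides_linP.
  move=> f k sf D k0 fk; apply: (divides_lin_middle U n2 hj).
  by apply: (@divides_scaled _ k%:P); rewrite -fk.
have [j [k [hj k0 fj Dj]]] := linear_factor U n2 sf D.
have jn := divides_lin_middle U n2 hj Dj.
have nj : (n = (j.-1).*2.+1)%N by rewrite -muln2; lia.
split; first by rewrite nj /= odd_double.
exists k; split=> //.
by have -> : ((n + 1) %/ 2 = j)%N by lia.
Qed.
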